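(* Let $$Z(s)=\frac{a_3s^3+a_2s^2+a_1s+a_0}{d_3s^3+d_2s^2+d_1s+d_0}$$ with $a_i,d_j>0$ for $i,j=0,1,2,3$, McMillan degree $\delta(Z(s))=3$, and no pole or zero on $j\mathbb{R}\cup\infty$. Then $Z(s)$ is realizable as a five-element series-parallel network if and only if $Z(s)$ is realizable as one of the following 22 configurations: $\mathcal{N}_{1a}$: $c_1\parallel[c_2+(k_1\parallel(k_2+b_1))]$; $\mathcal{N}_{1b}$: $c_1+[c_2\parallel(b_1+(b_2\parallel k_1))]$; $\mathcal{N}_{2a}$: $c_1\parallel[b_1+(k_1\parallel(k_2+c_2))]$; $\mathcal{N}_{2b}$: $c_1+[k_1\parallel(b_1+(b_2\parallel c_2))]$; $\mathcal{N}_{2c}$: $c_1\parallel[k_1+(b_1\parallel(b_2+c_2))]$; $\mathcal{N}_{2d}$: $c_1+[b_1\parallel(k_1+(k_2\parallel c_2))]$; $\mathcal{N}_{3a}$: $c_1\parallel[k_1+(b_1\parallel(k_2+c_2))]$; $\mathcal{N}_{3b}$: $c_1+[b_1\parallel(k_1+(b_2\parallel c_2))]$; $\mathcal{N}_{3c}$: $c_1\parallel[b_1+(k_1\parallel(b_2+c_2))]$; $\mathcal{N}_{3d}$: $c_1+[k_1\parallel(b_1+(k_2\parallel c_2))]$; $\mathcal{N}_{4a}$: $c_1\parallel[k_1+(c_2\parallel(k_2+b_1))]$; $\mathcal{N}_{4b}$: $c_1+[b_1\parallel(c_2+(b_2\parallel k_1))]$; $\mathcal{N}_{4c}$: $c_1\parallel[b_1+(c_2\parallel(b_2+k_1))]$;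 $\mathcal{N}_{4d}$: $c_1+[k_1\parallel(c_2+(k_2\parallel b_1))]$; $\mathcal{N}_{5a}$: $(c_1+k_1)\parallel[c_2+(k_2\parallel b_1)]$; $\mathcal{N}_{5b}$: $(c_1\parallel b_1)+[c_2\parallel(b_2+k_1)]$; $\mathcal{N}_{5c}$: $(c_1+b_1)\parallel[c_2+(b_2\parallel k_1)]$; $\mathcal{N}_{5d}$: $(c_1\parallel k_1)+[c_2\parallel(k_2+b_1)]$; $\mathcal{N}_{6a}$: $(c_1+k_1)\parallel[b_1+(k_2\parallel c_2)]$; $\mathcal{N}_{6b}$: $(c_1\parallel b_1)+[k_1\parallel(b_2+c_2)]$; $\mathcal{N}_{6c}$: $(c_1+b_1)\parallel[k_1+(b_2\parallel c_2)]$; $\mathcal{N}_{6d}$: $(c_1\parallel k_1)+[b_1\parallel(k_2+c_2)]$.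
   Context: Networks are two-terminal linear time-invariant networks consisting of dampers, springs and inerters with positive finite element values: a finite connected graph (multiple edges allowed) with two distinguished vertices $a,a'$ (the terminals), each edge being one element and, as usual, lying on some simple path from $a$ to $a'$. The impedance of a network is its driving-point impedance (velocity plays the role of voltage, force the role of current); a damper $c>0$ has impedance $1/c$, a spring $k>0$ has impedance $s/k$, an inerter $b>0$ has impedance $1/(bs)$. A network is series-parallel if it is a single element or a series or parallel connection of two smaller series-parallel networks. In the description of configurations, $c_i$, $k_i$, $b_i$ denote dampers, springs and inerters, $+$ denotes series connection (impedances add) and $\parallel$ denotes parallel connection (admittances, i.e. reciprocals of impedances, add). $Z(s)$ is realizable as a configuration if there are positive finite element values for which the impedance of the configuration equals $Z(s)$. For $Z=a/d$ with coprime polynomials $a,d$, the McMillan degree is $\delta(Z)=\max\{\deg a,\deg d\}$. *)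

(* Defs.v *)
From HB Require Import structures.
From mathcomp Require Import all_boot all_order all_algebra.
From mathcomp Require Import complex reals.

Set Implicit Arguments.
Unset Strict Implicit.
Unset Printing Implicit Defensive.

Import Order.TTheory GRing.Theory Num.Theory.
Local Open Scope ring_scope.

Notation "p %:F" := (@FracField.tofrac _ p) : ring_scope.

Section RationalFunctions.
Variable R : realType.
Implicit Types (Z : {fraction {poly R}}) (a d : {poly R}).

(* [a] and [d] are determined by [Z] up to a common nonzero constant, so the
   existential quantifications over representations below are harmless. *)
Definition coprime_rep Z a d : Prop :=
  [/\ coprimep a d, d != 0 & Z = a%:F / d%:F].

Definition McMillan_degree Z (n : nat) : Prop :=
  exists a d, coprime_rep Z a d /\ n = maxn (size a).-1 (size d).-1.

(* Points of the extended complex plane: [Some z] is the complex number [z],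
   [None] is the point at infinity. *)
Definition is_pole Z (p : option R[i]) : Prop :=
  exists a d, coprime_rep Z a d /\
    if p is Some z then root (map_poly (real_complex R) d) z
    else (size d < size a)%N.

Definition is_zero Z (p : option R[i]) : Prop :=
  exists a d, coprime_rep Z a d /\
    if p is Some z then root (map_poly (real_complex R) a) z
    else (size a < size d)%N.

Definition on_jR_infty (p : option R[i]) : Prop :=
  if p is Some z then complex.Re z = 0 else True.

End RationalFunctions.

Inductive kind := Damper | Spring | Inerter.

(* Series-parallel structures whose elements carry labels in [E]. *)
Inductive sp (E : Type) : Type :=
  | Elem of E
  | Series of sp E & sp E
  | Parallel of sp E & sp E.

Fixpoint sp_elements (E : Type) (N : sp E) : seq E :=
  match N with
  | Elem e => [:: e]
  | Series N1 N2 | Parallel N1 N2 => sp_elements N1 ++ sp_elements N2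
  end.

Fixpoint sp_map (E F : Type) (f : E -> F) (N : sp E) : sp F :=
  match N with
  | Elem e => Elem (f e)
  | Series N1 N2 => Series (sp_map f N1) (sp_map f N2)
  | Parallel N1 N2 => Parallel (sp_map f N1) (sp_map f N2)
  end.

Section Networks.
Variable R : realType.

Definition sp_network := sp (kind * R).

Definition positive_values (N : sp_network) : bool :=
  all (fun e => 0 < e.2) (sp_elements N).

Definition element_impedance (e : kind * R) : {fraction {poly R}} :=
  match e with
  | (Damper, c) => 1 / (c%:P)%:F
  | (Spring, k) => 'X%:F / (k%:P)%:F
  | (Inerter, b) => 1 / (b%:P * 'X)%:F
  end.

(* For positive element values every impedance and every sum of admittances
   below is nonzero (it is positive at each real s > 0), so the convention 0^-1 = 0
   plays no role. *)
Fixpoint impedance (N : sp_network) : {fraction {poly R}} :=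
  match N with
  | Elem e => element_impedance e
  | Series N1 N2 => impedance N1 + impedance N2
  | Parallel N1 N2 => ((impedance N1)^-1 + (impedance N2)^-1)^-1
  end.

Definition sp_realizable (n : nat) (Z : {fraction {poly R}}) : Prop :=
  exists N : sp_network,
    [/\ positive_values N, size (sp_elements N) = n & impedance N = Z].

End Networks.

(* The element (Damper, i) is c_i, (Spring, i) is k_i, (Inerter, i) is b_i. *)
Definition configuration := sp (kind * nat).

Definition assign_values (R : realType) (v : kind -> nat -> R)
    (C : configuration) : sp_network R :=
  sp_map (fun e => (e.1, v e.1 e.2)) C.

Definition realizable_as (R : realType) (C : configuration)
    (Z : {fraction {poly R}}) : Prop :=
  exists v : kind -> nat -> R,
    (forall t i, 0 < v t i) /\ impedance (assign_values v C) = Z.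

Declare Scope network_scope.
Delimit Scope network_scope with net.
Bind Scope network_scope with sp.
Notation "M + N" := (Series M N) : network_scope.
Notation "M || N" := (Parallel M N) : network_scope.

Section Configurations.
Local Open Scope network_scope.

Local Notation c1 := (Elem (Damper, 1%N)).
Local Notation c2 := (Elem (Damper, 2%N)).
Local Notation k1 := (Elem (Spring, 1%N)).
Local Notation k2 := (Elem (Spring, 2%N)).
Local Notation b1 := (Elem (Inerter, 1%N)).
Local Notation b2 := (Elem (Inerter, 2%N)).

Definition N1a : configuration := c1 || (c2 + (k1 || (k2 + b1))).
Definition N1b : configuration := c1 + (c2 || (b1 + (b2 || k1))).

Definition N2a : configuration := c1 || (b1 + (k1 || (k2 + c2))).
Definition N2b : configuration := c1 + (k1 || (b1 + (b2 || c2))).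
Definition N2c : configuration := c1 || (k1 + (b1 || (b2 + c2))).
Definition N2d : configuration := c1 + (b1 || (k1 + (k2 || c2))).

Definition N3a : configuration := c1 || (k1 + (b1 || (k2 + c2))).
Definition N3b : configuration := c1 + (b1 || (k1 + (b2 || c2))).
Definition N3c : configuration := c1 || (b1 + (k1 || (b2 + c2))).
Definition N3d : configuration := c1 + (k1 || (b1 + (k2 || c2))).

Definition N4a : configuration := c1 || (k1 + (c2 || (k2 + b1))).
Definition N4b : configuration := c1 + (b1 || (c2 + (b2 || k1))).
Definition N4c : configuration := c1 || (b1 + (c2 || (b2 + k1))).
Definition N4d : configuration := c1 + (k1 || (c2 + (k2 || b1))).

Definition N5a : configuration := (c1 + k1) || (c2 + (k2 || b1)).
Definition N5b : configuration := (c1 || b1) + (c2 || (b2 + k1)).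
Definition N5c : configuration := (c1 + b1) || (c2 + (b2 || k1)).
Definition N5d : configuration := (c1 || k1) + (c2 || (k2 + b1)).

Definition N6a : configuration := (c1 + k1) || (b1 + (k2 || c2)).
Definition N6b : configuration := (c1 || b1) + (k1 || (b2 + c2)).
Definition N6c : configuration := (c1 + b1) || (k1 + (b2 || c2)).
Definition N6d : configuration := (c1 || k1) + (b1 || (k2 + c2)).

End Configurations.

Definition the_22_configurations : seq configuration :=
  [:: N1a; N1b; N2a; N2b; N2c; N2d; N3a; N3b; N3c; N3d; N4a; N4b; N4c; N4d;
      N5a; N5b; N5c; N5d; N6a; N6b; N6c; N6d].

(* Main.v *)
Require Import Defs.
From HB Require Import structures.
From mathcomp Require Import all_boot all_order all_algebra.
From mathcomp Require Import complex reals ring zify.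
From Stdlib Require List.

(* A five-element series-parallel network is brought to a normal form by
   commutativity, associativity and the fusion of equal adjacent elements, which
   leaves a finite list of structures.  A structure is impossible for Z if
   - it has at most two reactive elements, so that Z has degree at most 2;
   - it is a short circuit (dually, open) at 0 or infinity, where Z is finite
     and nonzero;
   - it has a branch k + b in parallel with the rest (dually, k || b in series):
     by positive-realness the rest cannot cancel the pole of the admittance of
     k + b on the imaginary axis;
   - it is equivalent to c || (k + b + (k || b)), or its dual, whose lossless
     part has a zero on the imaginary axis.
   The remaining structures are the 22 configurations and ten others, which are
   turned into them by Zobel's equivalence
   y + (y || X) = y || (y + X), valid with other values of the y's and X rescaled. *)

Set Implicit Arguments.
Unset Strict Implicit.
Unset Printing Implicit Defensive.

Import Order.TTheory GRing.Theory Num.Theory.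
Local Open Scope ring_scope.

(** * Normal forms of network structures *)

Definition kind_code (t : kind) : nat :=
  match t with Damper => 0 | Spring => 1 | Inerter => 2 end.

Lemma kind_code_inj : injective kind_code. Proof. by do 2!case. Qed.

HB.instance Definition _ := Equality.copy kind (inj_type kind_code_inj).

Fixpoint sp_eqb (E : eqType) (M N : sp E) : bool :=
  match M, N with
  | Elem x, Elem y => x == y
  | Series M1 M2, Series N1 N2 | Parallel M1 M2, Parallel N1 N2 =>
      sp_eqb M1 N1 && sp_eqb M2 N2
  | _, _ => false
  end.

Lemma sp_eqbP (E : eqType) : Equality.axiom (@sp_eqb E).
Proof.
elim=> [x|M1 IH1 M2 IH2|M1 IH1 M2 IH2] [y|N1 N2|N1 N2] /=;
  do ?[exact: ReflectF].
- by apply: (iffP eqP) => [->|[]].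
- by apply: (iffP andP) => [[/IH1-> /IH2->]|[<- <-]];
    rewrite ?(introT (IH1 _)) ?(introT (IH2 _)).
- by apply: (iffP andP) => [[/IH1-> /IH2->]|[<- <-]];
    rewrite ?(introT (IH1 _)) ?(introT (IH2 _)).
Qed.

HB.instance Definition _ (E : eqType) := hasDecEq.Build (sp E) (@sp_eqbP E).

Local Notation tree := (sp kind).

Definition node (series : bool) : tree -> tree -> tree :=
  if series then @Series kind else @Parallel kind.

(** Structure of the networks with reciprocal impedance: inversion exchanges series with parallel
    and s with 1/s, hence springs with inerters. *)
Fixpoint dual (T : tree) : tree :=
  match T with
  | Elem Damper => Elem Damper
  | Elem Spring => Elem Inerter
  | Elem Inerter => Elem Spring
  | Series T1 T2 => Parallel (dual T1) (dual T2)
  | Parallel T1 T2 => Series (dual T1) (dual T2)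
  end.

(** Polish notation. Comparing these words with [lex_le] fixes the order of the operands of a
    commutative connection. *)
Fixpoint word (T : tree) : seq nat :=
  match T with
  | Elem t => [:: kind_code t]
  | Series T1 T2 => 3 :: word T1 ++ word T2
  | Parallel T1 T2 => 4 :: word T1 ++ word T2
  end%N.

Fixpoint lex_le (u v : seq nat) : bool :=
  match u, v with
  | x :: u', y :: v' => (x < y)%N || (x == y) && lex_le u' v'
  | [::], _ => true
  | _, _ => false
  end.

Definition same_elem (T1 T2 : tree) : bool :=
  if T1 is Elem _ then T1 == T2 else false.

(* With [merge], two elements of the same kind in series (or in parallel) are
   fused into one; without it, only associativity and commutativity are used,
   so that [canon false] loses no information. *)
Fixpoint insert (merge o : bool) (x T : tree) : tree :=
  let cons y T' rest :=
    if merge && same_elem x y then T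
    else if lex_le (word x) (word y) then node o x T else node o y rest in
  match o, T with
  | true, Series y T' => cons y T' (insert merge o x T')
  | false, Parallel y T' => cons y T' (insert merge o x T')
  | _, _ =>
    if merge && same_elem x T then T
    else if lex_le (word x) (word T) then node o x T else node o T x
  end.

(** In a normal form, a chain of connections of one type is a sorted list nested to the right; two
    such chains are joined by insertion sort. *)
Fixpoint join (merge o : bool) (T1 T2 : tree) : tree :=
  match o, T1 with
  | true, Series y T' => insert merge o y (join merge o T' T2)
  | false, Parallel y T' => insert merge o y (join merge o T' T2)
  | _, _ => insert merge o T1 T2
  end.

Fixpoint canon (merge : bool) (T : tree) : tree :=
  match T with
  | Elem t => Elem t
  | Series T1 T2 => join merge true (canon merge T1) (canon merge T2)
  | Parallel T1 T2 => join merge false (canon merge T1) (canon merge T2)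
  end.

Definition combine (trees : nat -> seq tree) (n : nat) : seq tree :=
  undup (flatten [seq [seq join true oi.1 T1 T2 |
      T1 <- trees oi.2, T2 <- trees (n - oi.2)%N]
    | oi <- [seq (o, i) | o <- [:: true; false], i <- iota 1 n.-1]]).

(** Here [n] counts the elements before fusion, so the list for [n] also contains normal forms with
    fewer elements. *)
Fixpoint canonical_trees (fuel n : nat) : seq tree :=
  if fuel isn't fuel'.+1 then [::] else
  if n == 1%N then [:: Elem Damper; Elem Spring; Elem Inerter]
  else combine (canonical_trees fuel') n.

Fixpoint reactive (T : tree) : nat :=
  match T with
  | Elem t => t != Damper
  | Series T1 T2 | Parallel T1 T2 => reactive T1 + reactive T2
  end.

(* Springs are short circuits at s = 0, inerters at infinity; the open circuits
   are the short circuits of the dual network. *)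
Fixpoint short (t : kind) (T : tree) : bool :=
  match T with
  | Elem u => u == t
  | Series T1 T2 => short t T1 && short t T2
  | Parallel T1 T2 => short t T1 || short t T2
  end.

Definition resonator (T : tree) : bool :=
  T \in [:: Series (Elem Spring) (Elem Inerter);
            Series (Elem Inerter) (Elem Spring)].

(** Only the right spine is searched, because normal forms nest their parallel branches to the
    right. *)
Fixpoint has_resonator (T : tree) : bool :=
  if T is Parallel T1 T2 then resonator T1 || has_resonator T2 else resonator T.

Local Notation c := (Elem Damper).
Local Notation k := (Elem Spring).
Local Notation b := (Elem Inerter).

Local Open Scope network_scope.

Definition one_damper : seq tree :=
  [:: c || (k + (b + (b || k))); c || (b + (k || (k + b)));
      c || (k + (b || (b + k)))].

Definition zobel_variants : seq tree :=
  [:: c + (c || (k + (k || b))); c + (c || (k || (k + b)));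
      c || (c + (k + (k || b)));
      c || (c + (b + (b || k))); c || (c + (b || (b + k)));
      c + (c || (b || (b + k)));
      c + (k || (b || (b + c))); c || (b + (k + (k || c)));
      c + (b || (k || (k + c))); c || (k + (b + (b || c)))].
Local Close Scope network_scope.

Definition structure (C : configuration) : tree := sp_map fst C.

(** Each test forces a zero of the impedance at 0, at infinity or on the imaginary axis; applied to
    [dual T], it forces a pole there. *)
Definition degenerate (T : tree) : bool :=
  [|| short Spring T, short Inerter T, has_resonator T
    | canon false T \in map (canon false) one_damper].

Definition settled (T : tree) : bool :=
  [|| (reactive T <= 2)%N, degenerate T, degenerate (dual T)
    | canon false T \in
        map (canon false) (map structure the_22_configurations ++ zobel_variants)].

(** The exhaustive case analysis over all structures, carried out by computation. *)
Lemma canonical_trees_settled : all settled (canonical_trees 5 5).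
Proof. by vm_compute. Qed.

(** * Networks realizing a given structure *)

Section Realizability.
Variable R : realType.
Local Notation F := {fraction {poly R}}.
Implicit Types (T : tree) (Z : F).

Definition cst : R -> F := @FracField.tofrac {poly R} \o polyC.
HB.instance Definition _ :=
  GRing.RMorphism.copy cst (@FracField.tofrac {poly R} \o polyC).

Lemma cstD x y : cst (x + y) = cst x + cst y. Proof. exact: rmorphD. Qed.

Lemma cstM x y : cst (x * y) = cst x * cst y. Proof. exact: rmorphM. Qed.

Lemma cstV x : cst x^-1 = (cst x)^-1. Proof. exact: fmorphV. Qed.

Definition unit_impedance (t : kind) : F :=
  match t with Damper => 1 | Spring => 'X%:F | Inerter => ('X%:F)^-1 end.

(** Each leaf has its own unknown value, so no labels are needed. The number [x] is the inverse of
    the element value, which makes the three kinds uniform. *)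
Fixpoint realizes T Z : Prop :=
  match T with
  | Elem t => exists2 x, 0 < x & Z = cst x * unit_impedance t
  | Series T1 T2 =>
      exists Z1 Z2, [/\ realizes T1 Z1, realizes T2 Z2 & Z = Z1 + Z2]
  | Parallel T1 T2 =>
      exists Z1 Z2, [/\ realizes T1 Z1, realizes T2 Z2 & Z = (Z1^-1 + Z2^-1)^-1]
  end.

Lemma polyX_frac_neq0 : 'X%:F != 0 :> F.
Proof. by rewrite tofrac_eq0 polyX_eq0. Qed.

Lemma unit_impedance_neq0 t : unit_impedance t != 0.
Proof. by case: t; rewrite /= ?invr_eq0 ?oner_eq0 ?polyX_frac_neq0. Qed.

Lemma cst_neq0 x : 0 < x -> cst x != 0.
Proof. by move=> x0; rewrite fmorph_eq0 gt_eqF. Qed.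

Lemma element_impedanceE t v :
  element_impedance (t, v) = cst v^-1 * unit_impedance t.
Proof.
rewrite fmorphV; case: t => /=; first by rewrite mulr1 div1r.
  by rewrite mulrC.
by rewrite div1r rmorphM invfM.
Qed.

Lemma realizes_impedance (N : sp_network R) :
  positive_values N -> realizes (sp_map fst N) (impedance N).
Proof.
rewrite /positive_values; elim: N => [[t v]|N1 IH1 N2 IH2|N1 IH1 N2 IH2] /=.
- rewrite andbT => v0; exists v^-1; first by rewrite invr_gt0.
  exact: element_impedanceE.
- rewrite all_cat => /andP[/IH1 H1 /IH2 H2].
  by exists (impedance N1), (impedance N2).
- rewrite all_cat => /andP[/IH1 H1 /IH2 H2].
  by exists (impedance N1), (impedance N2).
Qed.

Lemma eq_assign_values (v w : kind -> nat -> R) (C : configuration) :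
  {in sp_elements C, forall e, v e.1 e.2 = w e.1 e.2} ->
  assign_values v C = assign_values w C.
Proof.
rewrite /assign_values.
elim: C => [[t i]|C1 IH1 C2 IH2|C1 IH1 C2 IH2] /= eqvw.
- by rewrite (eqvw (t, i)) ?mem_head.
- by rewrite IH1 ?IH2 // => e e_in; apply: eqvw; rewrite mem_cat e_in ?orbT.
- by rewrite IH1 ?IH2 // => e e_in; apply: eqvw; rewrite mem_cat e_in ?orbT.
Qed.

(** Distinct labels let the values in the two halves of a configuration be chosen independently. *)
Lemma merge_values (C1 C2 : configuration) (v1 v2 : kind -> nat -> R) :
    (forall t i, 0 < v1 t i) -> (forall t i, 0 < v2 t i) ->
    uniq (sp_elements C1 ++ sp_elements C2) ->
  exists v, [/\ forall t i, 0 < v t i,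
    assign_values v C1 = assign_values v1 C1 &
    assign_values v C2 = assign_values v2 C2].
Proof.
move=> v1_gt0 v2_gt0; rewrite cat_uniq => /and3P[_ disj _].
exists (fun t i => if (t, i) \in sp_elements C1 then v1 t i else v2 t i); split.
- by move=> t i; case: ifP.
- by apply: eq_assign_values => -[t i] /= ->.
- apply: eq_assign_values => -[t i] /= in2.
  by rewrite ifN //; apply: contraNN disj => in1; apply/hasP; exists (t, i).
Qed.

Lemma realizes_realizable_as (C : configuration) Z :
  uniq (sp_elements C) -> realizes (structure C) Z -> realizable_as C Z.
Proof.
elim: C Z => [[t i]|C1 IH1 C2 IH2|C1 IH1 C2 IH2] Z /=.
- move=> _ [x x0 ->]; exists (fun _ _ => x^-1); split=> [*|].
    by rewrite invr_gt0.
  by have := element_impedanceE t x^-1; rewrite invrK.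
- move=> uC [Z1 [Z2 [H1 H2 ->]]].
  move: (uC); rewrite cat_uniq => /and3P[uC1 _ uC2].
  have [v1 [v1_gt0 E1]] := IH1 _ uC1 H1; have [v2 [v2_gt0 E2]] := IH2 _ uC2 H2.
  have [v [v_gt0 Ev1 Ev2]] := merge_values v1_gt0 v2_gt0 uC.
  exists v; split=> //; rewrite /assign_values /=.
  by rewrite -!/(assign_values _ _) Ev1 Ev2 E1 E2.
- move=> uC [Z1 [Z2 [H1 H2 ->]]].
  move: (uC); rewrite cat_uniq => /and3P[uC1 _ uC2].
  have [v1 [v1_gt0 E1]] := IH1 _ uC1 H1; have [v2 [v2_gt0 E2]] := IH2 _ uC2 H2.
  have [v [v_gt0 Ev1 Ev2]] := merge_values v1_gt0 v2_gt0 uC.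
  exists v; split=> //; rewrite /assign_values /=.
  by rewrite -!/(assign_values _ _) Ev1 Ev2 E1 E2.
Qed.

Lemma realizes_dual T Z : realizes T Z -> realizes (dual T) Z^-1.
Proof.
elim: T Z => [t|T1 IH1 T2 IH2|T1 IH1 T2 IH2] Z /=.
- move=> [x x0 ->].
  have E u : unit_impedance t * u = 1 ->
      (cst x * unit_impedance t)^-1 = cst x^-1 * u.
    move=> tu; rewrite invfM fmorphV; congr (_ * _).
    by rewrite -[LHS]mulr1 -tu mulKf ?unit_impedance_neq0.
  case: t E => E /=; exists x^-1; rewrite ?invr_gt0 //; apply: E => /=.
  + by rewrite mulr1.
  + by rewrite divff ?polyX_frac_neq0.
  + by rewrite mulVf ?polyX_frac_neq0.
- move=> [Z1 [Z2 [/IH1 H1 /IH2 H2 ->]]].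
  by exists Z1^-1, Z2^-1; rewrite !invrK.
- move=> [Z1 [Z2 [/IH1 H1 /IH2 H2 ->]]].
  by exists Z1^-1, Z2^-1; rewrite !invrK.
Qed.

Lemma dualK : involutive dual.
Proof. by elim=> [[]|? IH1 ? IH2|? IH1 ? IH2] //=; rewrite IH1 IH2. Qed.

Lemma realizes_scale T Z x : 0 < x -> realizes T Z -> realizes T (cst x * Z).
Proof.
move=> x0; elim: T Z => [t|T1 IH1 T2 IH2|T1 IH1 T2 IH2] Z /=.
- move=> [y y0 ->]; exists (x * y); first exact: mulr_gt0.
  by rewrite rmorphM mulrA.
- move=> [Z1 [Z2 [/IH1 H1 /IH2 H2 ->]]].
  by exists (cst x * Z1), (cst x * Z2); rewrite mulrDr.
- move=> [Z1 [Z2 [/IH1 H1 /IH2 H2 ->]]].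
  exists (cst x * Z1), (cst x * Z2); split=> //.
  by rewrite !invfM -mulrDr invfM invrK.
Qed.

Definition reduces T T' : Prop := forall Z, realizes T Z -> realizes T' Z.

Lemma reduces_trans T2 T1 T3 : reduces T1 T2 -> reduces T2 T3 -> reduces T1 T3.
Proof. by move=> H1 H2 Z /H1/H2. Qed.

Lemma reduces_dual T T' : reduces T T' -> reduces (dual T) (dual T').
Proof.
by move=> H Z /realizes_dual; rewrite dualK => /H/realizes_dual; rewrite invrK.
Qed.

Lemma reduces_node o T1 T2 T1' T2' :
  reduces T1 T1' -> reduces T2 T2' -> reduces (node o T1 T2) (node o T1' T2').
Proof.
by move=> H1 H2 Z; case: o => -[Z1 [Z2 [/H1 ? /H2 ? ->]]]; exists Z1, Z2.
Qed.

Lemma reduces_nodeC o T1 T2 : reduces (node o T1 T2) (node o T2 T1).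
Proof.
by move=> Z; case: o => -[Z1 [Z2 [? ? ->]]]; exists Z2, Z1; rewrite addrC.
Qed.

Lemma reduces_nodeA o T1 T2 T3 :
  reduces (node o (node o T1 T2) T3) (node o T1 (node o T2 T3)).
Proof.
move=> Z; case: o => -[_ [Z3 [[Z1 [Z2 [H1 H2 ->]]] H3 ->]]].
  by exists Z1, (Z2 + Z3); split; rewrite ?addrA //; exists Z2, Z3.
exists Z1, ((Z2^-1 + Z3^-1)^-1); split; rewrite ?invrK ?addrA //.
by exists Z2, Z3.
Qed.

Lemma reduces_nodeA' o T1 T2 T3 :
  reduces (node o T1 (node o T2 T3)) (node o (node o T1 T2) T3).
Proof.
apply: reduces_trans (@reduces_nodeC o _ _) _.
apply: reduces_trans (@reduces_nodeA o _ _ _) _.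
apply: reduces_trans (@reduces_nodeC o _ _) _.
apply: reduces_trans (@reduces_nodeA o _ _ _) _.
exact: reduces_nodeC.
Qed.

Lemma reduces_nodeCA o T1 T2 T3 :
  reduces (node o T1 (node o T2 T3)) (node o T2 (node o T1 T3)).
Proof.
apply: reduces_trans (@reduces_nodeA' o _ _ _) _.
apply: reduces_trans (@reduces_nodeA o _ _ _).
by apply: reduces_node => //; apply: reduces_nodeC.
Qed.

Lemma reduces_merge o t : reduces (node o (Elem t) (Elem t)) (Elem t).
Proof.
have series u : reduces (Series (Elem u) (Elem u)) (Elem u).
  move=> _ [_ [_ [[x x0 ->] [y y0 ->] ->]]]; exists (x + y).
    exact: addr_gt0.
  by rewrite rmorphD mulrDl.
case: o; first exact: series.
(* Parallel fusion is the dual of series fusion, with springs and inerters exchanged. *)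
have parallel u := reduces_dual (series u).
case: t.
- exact: parallel Damper.
- exact: parallel Inerter.
- exact: parallel Spring.
Qed.

(* [canon_rel false] is the equivalence of networks, and [canon_rel true] is
   [reduces]. *)
Definition canon_rel merge T T' := reduces T T' /\ (merge \/ reduces T' T).

(** * Soundness of the normal forms *)

Section Canon.
Variable merge : bool.
Local Notation rel := (canon_rel merge).

Lemma canon_rel_refl T : rel T T.
Proof. by split; [|right]. Qed.

Lemma canon_rel_trans T2 T1 T3 : rel T1 T2 -> rel T2 T3 -> rel T1 T3.
Proof.
move=> [H1 H1'] [H2 H2']; split; first exact: reduces_trans H2.
case: H1' => [|H1']; first by left.
case: H2' => [|H2']; first by left.
by right; apply: reduces_trans H1'.
Qed.

Lemma canon_rel_node o T1 T2 T1' T2' :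
  rel T1 T1' -> rel T2 T2' -> rel (node o T1 T2) (node o T1' T2').
Proof.
move=> [H1 H1'] [H2 H2']; split; first exact: reduces_node.
case: H1' => [|H1']; first by left.
case: H2' => [|H2']; first by left.
by right; apply: reduces_node.
Qed.

Lemma canon_rel_equiv T T' : reduces T T' -> reduces T' T -> rel T T'.
Proof. by split; [|right]. Qed.

Lemma canon_rel_merge o T1 T2 :
  merge && same_elem T1 T2 -> rel (node o T1 T2) T2.
Proof.
case: T1 => //= [t||]; rewrite ?andbF // => /andP[mg /eqP <-].
by split; [exact: reduces_merge | left].
Qed.

Lemma canon_rel_insert_leaf o x T :
  rel (node o x T)
    (if merge && same_elem x T then T
     else if lex_le (word x) (word T) then node o x T else node o T x).
Proof.
case: ifP => [/canon_rel_merge//|_]; case: ifP => _; first exact: canon_rel_refl.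
by apply: canon_rel_equiv; apply: reduces_nodeC.
Qed.

Lemma canon_rel_insert_cons o x y T' rest :
  rel (node o x T') rest ->
  rel (node o x (node o y T'))
    (if merge && same_elem x y then node o y T'
     else if lex_le (word x) (word y) then node o x (node o y T')
     else node o y rest).
Proof.
move=> H; case: ifP => [mxy|_].
  apply: canon_rel_trans _
    (canon_rel_node o (canon_rel_merge o mxy) (canon_rel_refl T')).
  by apply: canon_rel_equiv; [apply: reduces_nodeA' | apply: reduces_nodeA].
case: ifP => _; first exact: canon_rel_refl.
apply: canon_rel_trans _ (canon_rel_node o (canon_rel_refl y) H).
by apply: canon_rel_equiv; apply: reduces_nodeCA.
Qed.

Lemma canon_rel_insert o x T : rel (node o x T) (insert merge o x T).
Proof.
elim: T => [t|T1 _ T2|T1 _ T2]; case: o => //=;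
  try by move=> *; first [exact: (@canon_rel_insert_leaf true) |
    exact: (@canon_rel_insert_leaf false)].
all: by move=> *; first [exact: (@canon_rel_insert_cons true) |
    exact: (@canon_rel_insert_cons false)].
Qed.

Lemma canon_rel_join_cons o y T' T2 rest : rel (node o T' T2) rest ->
  rel (node o (node o y T') T2) (insert merge o y rest).
Proof.
move=> H; apply: canon_rel_trans _ (canon_rel_insert o y rest).
apply: canon_rel_trans _ (canon_rel_node o (canon_rel_refl y) H).
by apply: canon_rel_equiv; [apply: reduces_nodeA | apply: reduces_nodeA'].
Qed.

Lemma canon_rel_join o T1 T2 : rel (node o T1 T2) (join merge o T1 T2).
Proof.
elim: T1 => [t|U1 _ U2|U1 _ U2]; case: o => /=;
  try by move=> *; first [exact: (@canon_rel_insert true) |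
    exact: (@canon_rel_insert false)].
all: by move=> *; first [exact: (@canon_rel_join_cons true) |
    exact: (@canon_rel_join_cons false)].
Qed.

Lemma canon_relP T : rel T (canon merge T).
Proof.
elim: T => [t|T1 IH1 T2 IH2|T1 IH1 T2 IH2] /=; first exact: canon_rel_refl.
- apply: canon_rel_trans (canon_rel_join true _ _).
  exact: (@canon_rel_node true).
- apply: canon_rel_trans (canon_rel_join false _ _).
  exact: (@canon_rel_node false).
Qed.

End Canon.

Lemma reduces_canon merge T : reduces T (canon merge T).
Proof. by case: (canon_relP merge T). Qed.

(** Without fusion, normalization can be undone: go from [T] to the common normal form and back to
    [T']. *)
Lemma reduces_same_canon T T' : canon false T = canon false T' -> reduces T T'.
Proof.
move=> eqTT'; have [H _] := canon_relP false T.
have [_ [//|H']] := canon_relP false T'.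
by apply: reduces_trans H _; rewrite eqTT'.
Qed.

End Realizability.

(** * Values of impedances at complex points *)

Section Values.
Variable R : realType.
Local Notation F := {fraction {poly R}}.
Implicit Types (T : tree) (Z : F) (s w : R[i]).

Definition ev (p : {poly R}) s : R[i] := (map_poly (real_complex R) p).[s].

Lemma evD p q s : ev (p + q) s = ev p s + ev q s.
Proof. by rewrite /ev rmorphD hornerD. Qed.

Lemma evM p q s : ev (p * q) s = ev p s * ev q s.
Proof. by rewrite /ev rmorphM hornerM. Qed.

Lemma evC x s : ev x%:P s = x%:C%C.
Proof. by rewrite /ev map_polyC hornerC. Qed.

Lemma evX s : ev 'X s = s.
Proof. by rewrite /ev map_polyX hornerX. Qed.

Lemma ev1 s : ev 1 s = 1.
Proof. by rewrite -polyC1 evC. Qed.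

Lemma ev0 s : ev 0 s = 0.
Proof. by rewrite -polyC0 evC. Qed.

Definition evE := (evD, evM, evC, evX, ev1, ev0).

Lemma ev_neq0 p s : ev p s != 0 -> p%:F != 0 :> F.
Proof. by apply: contraNneq => /eqP; rewrite tofrac_eq0 => /eqP ->; rewrite ev0. Qed.

Lemma frac_cross (p q p' q' : {poly R}) : p%:F / q%:F = p'%:F / q'%:F :> F ->
  q != 0 -> q' != 0 -> p * q' = p' * q.
Proof.
move=> E q0 q'0; apply/eqP; rewrite -tofrac_eq !tofracM.
have qF : q%:F != 0 :> F by rewrite tofrac_eq0.
have qF' : q'%:F != 0 :> F by rewrite tofrac_eq0.
by rewrite -(eqr_div _ _ qF qF') E.
Qed.

(* The value at [s] is only defined at points that are neither a pole nor a
   zero of [Z]. *)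
Definition has_value Z s w : Prop := exists p q,
  [/\ Z = p%:F / q%:F, ev p s != 0, ev q s != 0 & w = ev p s / ev q s].

Lemma has_value_neq0 Z s w : has_value Z s w -> Z != 0.
Proof.
move=> [p [q [-> /ev_neq0 p0 /ev_neq0 q0 _]]].
exact: mulf_neq0 p0 (invr_neq0 q0).
Qed.

Lemma has_valueV Z s w : has_value Z s w -> has_value Z^-1 s w^-1.
Proof. by move=> [p [q [-> p0 q0 ->]]]; exists q, p; rewrite !invf_div. Qed.

Lemma has_valueD Z1 Z2 s w1 w2 : w1 + w2 != 0 ->
  has_value Z1 s w1 -> has_value Z2 s w2 -> has_value (Z1 + Z2) s (w1 + w2).
Proof.
move=> w0 [p1 [q1 [-> p10 q10 E1]]] [p2 [q2 [-> p20 q20 E2]]].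
rewrite {}E1 {}E2 in w0 *.
exists (p1 * q2 + p2 * q1), (q1 * q2); split.
- rewrite tofracD !tofracM.
  exact: addf_div (ev_neq0 q10) (ev_neq0 q20).
- by move: w0; rewrite addf_div // !evE mulf_eq0 => /norP[].
- by rewrite evM mulf_neq0.
- by rewrite addf_div // !evE.
Qed.

Lemma has_value_parallel Z1 Z2 s w1 w2 : w1^-1 + w2^-1 != 0 ->
  has_value Z1 s w1 -> has_value Z2 s w2 ->
  has_value (Z1^-1 + Z2^-1)^-1 s (w1^-1 + w2^-1)^-1.
Proof. by move=> w0 H1 H2; apply/has_valueV/has_valueD => //; exact: has_valueV. Qed.

(** The product form transfers the value to any fraction for [Z], even one whose numerator and
    denominator both vanish at [s]. *)
Lemma has_value_ev Z s w a d : Z = a%:F / d%:F -> d != 0 ->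
  has_value Z s w -> ev a s = w * ev d s.
Proof.
move=> Za d0 [p [q [Zp p0 q0 ->]]].
have /frac_cross : a%:F / d%:F = p%:F / q%:F :> F by rewrite -Za.
have q_neq0 : q != 0 by apply: contraNneq q0 => ->; rewrite ev0.
move=> /(_ d0 q_neq0) /(congr1 (ev^~ s)).
by rewrite !evM mulrAC => <-; rewrite mulfK.
Qed.

Definition unit_value (t : kind) s :=
  match t with Damper => 1 | Spring => s | Inerter => s^-1 end.

Lemma has_value_elem t x s : s != 0 -> 0 < x ->
  has_value (cst x * unit_impedance R t) s (x%:C%C * unit_value t s).
Proof.
move=> s0 x0; have xC : x%:C%C != 0 :> R[i] by rewrite fmorph_eq0 gt_eqF.
case: t => /=.
- by exists x%:P, 1; rewrite !evE rmorph1 !divr1 !mulr1 oner_neq0.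
- exists (x%:P * 'X), 1.
  by rewrite !evE rmorph1 !divr1 oner_neq0 mulf_neq0 // rmorphM.
- by exists x%:P, 'X; rewrite !evE.
Qed.

(** * Sets of values stable under series and parallel connection *)

Section Cone.
Variables (P : R[i] -> Prop) (s : R[i]).
Hypotheses (P_neq0 : forall w, P w -> w != 0) (s_neq0 : s != 0).
Hypotheses (PD : forall w1 w2, P w1 -> P w2 -> P (w1 + w2)).
Hypotheses (PV : forall w, P w -> P w^-1).
Hypotheses (P_elem : forall t x, 0 < x -> P (x%:C%C * unit_value t s)).

(** Sums and inverses stay in [P], hence never vanish, so the value is defined at every node of the
    tree. The lemma is used for the positive reals and for the open right half-plane. *)
Lemma cone_value T Z : realizes T Z -> exists2 w, P w & has_value Z s w.
Proof.
elim: T Z => [t|T1 IH1 T2 IH2|T1 IH1 T2 IH2] Z /=.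
- move=> [x x0 ->]; exists (x%:C%C * unit_value t s); first exact: P_elem.
  exact: has_value_elem.
- move=> [Z1 [Z2 [/IH1[w1 P1 v1] /IH2[w2 P2 v2] ->]]].
  by exists (w1 + w2); [exact: PD | apply: has_valueD => //; exact/P_neq0/PD].
- move=> [Z1 [Z2 [/IH1[w1 P1 v1] /IH2[w2 P2 v2] ->]]].
  have PY : P (w1^-1 + w2^-1) by apply: PD; exact: PV.
  exists (w1^-1 + w2^-1)^-1; first exact: PV.
  by apply: has_value_parallel => //; exact: P_neq0.
Qed.

End Cone.

Lemma ltC0 x : 0 < x -> 0 < x%:C%C :> R[i].
Proof. by rewrite ltcR. Qed.

Lemma realC x : x%:C%C \is @Num.real R[i].
Proof. by rewrite realE !lecR; apply: num_real. Qed.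

Lemma positive_value T Z s : 0 < s -> realizes T Z ->
  exists2 w, 0 < w & has_value Z s w.
Proof.
move=> s0; apply: cone_value => [w /gt_eqF->//||w1 w2|w|t x x0].
- by rewrite gt_eqF.
- exact: addr_gt0.
- by rewrite invr_gt0.
- by rewrite mulr_gt0 ?ltC0 //; case: t; rewrite /= ?invr_gt0.
Qed.

(** The value at s = 1 is positive. *)
Lemma realizes_neq0 T Z : realizes T Z -> Z != 0.
Proof. by move=> /(positive_value ltr01)[w _ /has_value_neq0]. Qed.

Lemma Re_inv_gt0 w : 0 < 'Re w -> 0 < 'Re w^-1.
Proof.
move=> w0; have w_neq0 : w != 0 by apply: contraTneq w0 => ->; rewrite raddf0 ltxx.
by rewrite ReV divr_gt0 // exprn_gt0 // normr_gt0.
Qed.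

(** Positive-realness of network impedances. *)
Lemma positive_real_value T Z s : 0 < 'Re s -> realizes T Z ->
  exists2 w, 0 < 'Re w & has_value Z s w.
Proof.
have neq0 w : 0 < 'Re w -> w != 0.
  by move=> w0; apply: contraTneq w0 => ->; rewrite raddf0 ltxx.
move=> s0; apply: cone_value => [w /neq0//||w1 w2 H1 H2|w|t x x0].
- exact: neq0.
- by rewrite raddfD addr_gt0.
- exact: Re_inv_gt0.
- rewrite ReMl ?gtr0_real ?ltC0 // mulr_gt0 ?ltC0 //.
  by case: t; rewrite //= ?Re_inv_gt0 // (Creal_ReP _ _) ?ltr01 ?rpred1.
Qed.

(** The new values come from two limits: an open [X] leaves (x + y) u on both sides, a
    short-circuited [X] leaves x u. The remaining freedom is the factor that rescales [X]. *)
Lemma zobel_identity (K : fieldType) (x y u X : K) :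
    y != 0 -> x + y != 0 -> u != 0 -> X != 0 -> y * u + X != 0 ->
    x * y * u + (x + y) * X != 0 ->
  x * u + ((y * u)^-1 + X^-1)^-1 =
  (((x + y) * u)^-1 + ((x + y) * x / y * u + ((x + y) / y) ^+ 2 * X)^-1)^-1.
Proof.
move=> y0 xy0 u0 X0 yX0 xyX0; field.
(* The denominators left by [field] factor into terms that are nonzero by hypothesis. *)
have -> : (x + y) * x * u * y + (x + y) ^+ 2 * X + y * y * ((x + y) * u)
  = (x + y) ^+ 2 * (y * u + X) by ring.
have -> : (x + y) * x * u * y + (x + y) ^+ 2 * X
  = (x + y) * (x * y * u + (x + y) * X) by ring.
by rewrite addrC in yX0 *; rewrite !mulf_neq0 ?expf_neq0 ?y0 ?u0 ?X0 ?xy0 ?yX0.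
Qed.

Lemma reduces_zobel_series t T :
  reduces R (Series (Elem t) (Parallel (Elem t) T))
           (Parallel (Elem t) (Series (Elem t) T)).
Proof.
move=> _ [_ [_ [[x x0 ->] [_ [X [[y y0 ->] HX ->]]] ->]]].
have u0 := unit_impedance_neq0 R t.
have xy0 : 0 < x + y by apply: addr_gt0.
have elem z : 0 < z -> realizes (Elem t) (cst z * unit_impedance R t) by exists z.
(* The denominators of the identity do not vanish because they are themselves impedances of
   networks. *)
have yX0 : cst y * unit_impedance R t + X != 0.
  apply: (@realizes_neq0 (Series (Elem t) T)).
  by exists (cst y * unit_impedance R t), X; split=> //; exact: elem.
have xyX0 : cst (x * y) * unit_impedance R t + cst (x + y) * X != 0.
  apply: (@realizes_neq0 (Series (Elem t) T)).
  exists (cst (x * y) * unit_impedance R t), (cst (x + y) * X).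
  by split; [apply/elem/mulr_gt0 | apply: realizes_scale |].
exists (cst (x + y) * unit_impedance R t),
  (cst ((x + y) * x / y) * unit_impedance R t
   + cst ((x + y) / y * ((x + y) / y)) * X).
split; first exact: elem.
  exists (cst ((x + y) * x / y) * unit_impedance R t),
    (cst ((x + y) / y * ((x + y) / y)) * X).
  split=> //; first by apply/elem/divr_gt0 => //; apply: mulr_gt0.
  by apply: realizes_scale HX; apply: mulr_gt0; apply: divr_gt0.
have xyF := cst_neq0 xy0; rewrite cstD in xyF.
rewrite cstM cstD in xyX0.
rewrite (zobel_identity (cst_neq0 y0) xyF u0 (realizes_neq0 HX) yX0 xyX0).
by rewrite !(cstM, cstV) cstD.
Qed.

End Values.

(** * Impossible structures *)

Section Exclusion.
Variable R : realType.
Local Notation F := {fraction {poly R}}.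
Implicit Types (T : tree) (Z : F) (s w : R[i]) (p a d : {poly R}).

Definition degree_le n Z := exists p q : {poly R},
  [/\ Z = p%:F / q%:F, q != 0, (size p <= n.+1)%N & (size q <= n.+1)%N].

Lemma degree_leV n Z : Z != 0 -> degree_le n Z -> degree_le n Z^-1.
Proof.
move=> Z0 [p [q [E q0 sp sq]]]; exists q, p; split=> //.
  by rewrite E invf_div.
by apply: contraNneq Z0 => p0; rewrite E p0 tofrac0 mul0r.
Qed.

Lemma size_mul_leS m n (p q : {poly R}) :
  (size p <= m.+1 -> size q <= n.+1 -> size (p * q)%R <= (m + n).+1)%N.
Proof.
move=> sp sq; apply: leq_trans (size_polyMleq _ _) _.
by rewrite -subn1 leq_subLR (leq_trans (leq_add sp sq)) // addSn addnS.
Qed.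

Lemma degree_leD m n Z1 Z2 :
  degree_le m Z1 -> degree_le n Z2 -> degree_le (m + n) (Z1 + Z2).
Proof.
move=> [p1 [q1 [-> q10 sp1 sq1]]] [p2 [q2 [-> q20 sp2 sq2]]].
exists (p1 * q2 + p2 * q1), (q1 * q2); split.
- rewrite tofracD !tofracM.
  by apply: addf_div; rewrite tofrac_eq0.
- exact: mulf_neq0.
- apply: leq_trans (size_polyD _ _) _; rewrite geq_max size_mul_leS //=.
  by rewrite addnC size_mul_leS.
- exact: size_mul_leS.
Qed.

(** Degree is subadditive under sums and invariant under inversion; an element contributes one if it
    is reactive and nothing if it is a damper. *)
Lemma realizes_degree T Z : realizes T Z -> degree_le (reactive T) Z.
Proof.
elim: T Z => [t|T1 IH1 T2 IH2|T1 IH1 T2 IH2] Z /=.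
- move=> [x x0 ->]; case: t => /=.
  + exists x%:P, 1; rewrite oner_neq0 size_polyC size_poly1 leq_b1.
    by rewrite tofrac1 divr1 mulr1.
  + exists (x%:P * 'X), 1; rewrite oner_neq0 size_poly1 tofrac1 divr1 tofracM.
    by split=> //; rewrite size_mulX ?polyC_eq0 ?gt_eqF // size_polyC ltnS leq_b1.
  + exists x%:P, 'X; rewrite polyX_eq0 size_polyX size_polyC.
    by split=> //; rewrite ltnW // ltnS leq_b1.
- by move=> [Z1 [Z2 [/IH1 H1 /IH2 H2 ->]]]; exact: degree_leD.
- move=> HZ; have := @realizes_neq0 _ (Parallel T1 T2) _ HZ.
  case: HZ => Z1 [Z2 [H1 H2 ->]]; rewrite invr_eq0 => Y0.
  apply: (degree_leV Y0); apply: degree_leD; apply: degree_leV.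
  + exact: realizes_neq0 H1.
  + exact: IH1.
  + exact: realizes_neq0 H2.
  + exact: IH2.
Qed.

Lemma parallel_value_le (w1 w2 : R[i]) : 0 < w1 -> 0 < w2 ->
  0 < (w1^-1 + w2^-1)^-1 <= w1.
Proof.
move=> w10 w20; have Y0 : 0 < w1^-1 + w2^-1 by rewrite addr_gt0 ?invr_gt0.
rewrite invr_gt0 Y0 -[leRHS]invrK lef_pV2 ?posrE ?invr_gt0 //.
by rewrite lerDl invr_ge0 ltW.
Qed.

(** The map [g] parametrizes the positive half-line so that the unit impedance of kind [t] equals x.
    As x tends to 0, [g x] tends to the point where [t] is a short circuit, and the impedance is
    O(x). *)
Lemma short_value t (g : R[i] -> R[i]) T Z :
    (forall x, 0 < x -> 0 < g x) -> (forall x, 0 < x -> unit_value t (g x) = x) ->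
    short t T -> realizes T Z ->
  exists2 M, 0 < M & forall x, 0 < x ->
    exists2 w, 0 < w <= M * x & has_value Z (g x) w.
Proof.
move=> g0 gt; elim: T Z => [u|T1 IH1 T2 IH2|T1 IH1 T2 IH2] Z /=.
- move=> /eqP-> [x x0 ->]; exists x%:C%C => [|y y0]; first exact: ltC0.
  exists (x%:C%C * y); first by rewrite lexx mulr_gt0 ?ltC0.
  by have := @has_value_elem _ t x (g y) _ x0; rewrite gt // gt_eqF ?g0 //; apply.
- move=> /andP[s1 s2] [Z1 [Z2 [/(IH1 _ s1)[M1 M10 H1] /(IH2 _ s2)[M2 M20 H2] ->]]].
  exists (M1 + M2) => [|x x0]; first exact: addr_gt0.
  have [w1 /andP[w10 le1] v1] := H1 x x0; have [w2 /andP[w20 le2] v2] := H2 x x0.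
  exists (w1 + w2); first by rewrite addr_gt0 //= mulrDl lerD.
  by apply: has_valueD => //; rewrite gt_eqF ?addr_gt0.
(* One shorted branch suffices: on the positive half-line, a further parallel branch only lowers the
   impedance. *)
- have aux T1' T2' Z1 Z2 :
      (exists2 M, 0 < M & forall x, 0 < x ->
         exists2 w, 0 < w <= M * x & has_value Z1 (g x) w) ->
      realizes T2' Z2 ->
      exists2 M, 0 < M & forall x, 0 < x -> exists2 w, 0 < w <= M * x &
        has_value (Z1^-1 + Z2^-1)^-1 (g x) w.
    move=> [M M0 H1] H2; exists M => // x x0.
    have [w1 /andP[w10 le1] v1] := H1 x x0.
    have [w2 w20 v2] := positive_value (g0 x x0) H2.
    have /andP[w0 lew] := parallel_value_le w10 w20.
    exists (w1^-1 + w2^-1)^-1; first by rewrite w0 (le_trans lew).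
    by apply: has_value_parallel => //; rewrite -invr_eq0 gt_eqF.
  move=> /orP[s1|s2] [Z1 [Z2 [H1 H2 ->]]].
    by apply: aux H2 => //; exact: IH1.
  by rewrite addrC; apply: aux H1 => //; exact: IH2.
Qed.

Definition positive_cubic (p : {poly R}) :=
  size p = 4%N /\ forall i, (i < 4)%N -> 0 < p`_i.

Lemma ev_cubic p s : size p = 4%N ->
  ev p s = (p`_0)%:C%C + (p`_1)%:C%C * s + (p`_2)%:C%C * s ^+ 2
    + (p`_3)%:C%C * s ^+ 3.
Proof.
move=> sp; rewrite /ev horner_coef size_map_poly sp !big_ord_recr big_ord0 /=.
by rewrite !coef_map /= add0r expr0 mulr1 expr1.
Qed.

Lemma cubic_sum_bounds (f : nat -> R[i]) x : 0 < x <= 1 ->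
    (forall i, (i < 4)%N -> 0 < f i) ->
  f 0%N <= f 0%N + f 1%N * x + f 2%N * x ^+ 2 + f 3%N * x ^+ 3
    <= f 0%N + f 1%N + f 2%N + f 3%N.
Proof.
move=> /andP[x0 x1] f0.
have bnd i n : (i < 4)%N -> 0 <= f i * x ^+ n <= f i.
  move=> /f0/ltW fi; rewrite mulr_ge0 ?exprn_ge0 ?(ltW x0) //=.
  by rewrite ler_piMr ?exprn_ile1 ?(ltW x0).
have /andP[l1 u1] := bnd 1%N 1%N isT; rewrite expr1 in l1 u1.
have /andP[l2 u2] := bnd 2%N 2%N isT; have /andP[l3 u3] := bnd 3%N 3%N isT.
apply/andP; split; last by rewrite !lerD.
by rewrite -!addrA lerDl !addr_ge0.
Qed.

Lemma not_all_small (A B : R[i]) : 0 < A -> 0 < B ->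
  ~ (forall x, 0 < x <= 1 -> A <= B * x).
Proof.
move=> A0 B0 H; have AB0 : 0 < A + B by rewrite addr_gt0.
(* At x = A / (A + B) the product B x is smaller than A. *)
have /H : 0 < A / (A + B) <= 1.
  by rewrite divr_gt0 //= ler_pdivrMr // mul1r lerDl ltW.
rewrite mulrA ler_pdivlMr // mulrC ler_pM2r // gerDr.
by move/(lt_le_trans A0); rewrite ltxx.
Qed.

(** Near a short circuit Z is O(x), whereas the numerator stays above a positive constant and the
    denominator stays bounded. *)
Lemma short_excluded a d T Z : Z = a%:F / d%:F ->
  positive_cubic a -> positive_cubic d -> realizes T Z ->
  ~~ (short Spring T || short Inerter T).
Proof.
move=> Za [sa a0] [sd d0] HZ; apply/negP => sT.
have dN0 : d != 0 by rewrite -size_poly_eq0 sd.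
(* [f] and [e] are the coefficients of [a] and [d], in increasing order for the point 0 and reversed
   for infinity, where s = 1/x and both sides are multiplied by x^3. *)
have [f [e [f0 e0 [M M0 H]]]] : exists f e : nat -> R[i],
    [/\ forall i, (i < 4)%N -> 0 < f i, forall i, (i < 4)%N -> 0 < e i &
      exists2 M, 0 < M & forall x, 0 < x ->
        f 0%N + f 1%N * x + f 2%N * x ^+ 2 + f 3%N * x ^+ 3
        <= M * x * (e 0%N + e 1%N * x + e 2%N * x ^+ 2 + e 3%N * x ^+ 3)].
  case/orP: sT => sT.
    exists (fun i => (a`_i)%:C%C), (fun i => (d`_i)%:C%C).
    split; [by move=> i /a0/ltC0 | by move=> i /d0/ltC0 |].
    have [//|//|M M0 H] := @short_value Spring id T Z _ _ sT HZ.
    exists M => // x x0; have [w /andP[_ wle] /(has_value_ev Za dN0)] := H x x0.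
    rewrite !ev_cubic // => ->; rewrite ler_wpM2r //.
    by rewrite !addr_ge0 ?mulr_ge0 ?exprn_ge0 ?ltW ?ltC0 ?d0.
  exists (fun i => (a`_(3 - i))%:C%C), (fun i => (d`_(3 - i))%:C%C).
  split; [by move=> i _; rewrite ltC0 ?a0 ?ltnS ?leq_subr |
          by move=> i _; rewrite ltC0 ?d0 ?ltnS ?leq_subr |].
  have [x|x|M M0 H] := @short_value Inerter GRing.inv T Z _ _ sT HZ.
  - by rewrite invr_gt0.
  - by rewrite /= invrK.
  exists M => // x x0; have [w /andP[_ wle] /(has_value_ev Za dN0)] := H x x0.
  have rev p : size p = 4%N -> ev p x^-1 * x ^+ 3 =
      (p`_3)%:C%C + (p`_2)%:C%C * x + (p`_1)%:C%C * x ^+ 2 + (p`_0)%:C%C * x ^+ 3.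
    by move=> sp; rewrite ev_cubic //; field; rewrite gt_eqF.
  have Ed := rev d sd; rewrite /= -(rev a sa) -Ed => ->.
  rewrite -[leLHS]mulrA ler_wpM2r // Ed.
  by rewrite !addr_ge0 ?mulr_ge0 ?exprn_ge0 ?ltW ?ltC0 ?d0.
have e_sum : 0 < e 0%N + e 1%N + e 2%N + e 3%N by rewrite !addr_gt0 ?e0.
apply: (not_all_small (f0 0%N isT) (mulr_gt0 M0 e_sum)) => x /[dup] x01 /andP[x0 _].
have /andP[lef _] := cubic_sum_bounds x01 f0.
have /andP[_ ege] := cubic_sum_bounds x01 e0.
apply: le_trans lef _; apply: le_trans (H x x0) _.
by rewrite [leRHS]mulrAC ler_wpM2l // mulr_ge0 // ltW.
Qed.

(** A pole of the admittance at i r, expressed by the growth of its real part when i r is approached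
    from the right; this bound survives the addition of admittances with positive real part. *)
Definition resonant Z := exists r : R, exists2 m : R[i], 0 < m &
  forall e, 0 < e -> exists2 w, m / e <= 'Re w^-1 & has_value Z (e + 'i * r%:C%C) w.

Lemma resonator_value x y : 0 < x -> 0 < y ->
  resonant (cst x * 'X%:F + cst y * ('X%:F)^-1).
Proof.
(* At s = i r the impedance x s + y / s vanishes; the constant 1 / (2 x) chosen next is the residue
   of the admittance there. *)
move=> x0 y0; pose r := Num.sqrt (y / x); exists r.
have r2 : x * r ^+ 2 = y by rewrite sqr_sqrtr ?divr_ge0 ?ltW // mulrC divfK ?gt_eqF.
exists (2^-1 / x%:C%C); first by rewrite divr_gt0 ?invr_gt0 ?ltr0n ?ltC0.
move=> e e0; set rC := r%:C%C; set s := e + _.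
have rC_real : rC \is Num.real by apply: realC.
have e_real := gtr0_real e0.
have sRe : 'Re s = e by rewrite Re_rect.
have s2Re : 'Re (e + 'i * (2 * rC)) = e by rewrite Re_rect // realM // realn.
have s0 : s != 0 by apply: contraTneq e0 => s0; rewrite -sRe s0 raddf0 ltxx.
have s20 : e + 'i * (2 * rC) != 0.
  by apply: contraTneq e0 => s0'; rewrite -s2Re s0' raddf0 ltxx.
have xC0 := ltC0 x0.
(* This is x s^2 + y = x (s - i r) (s + i r) at s = e + i r. *)
have E : x%:C%C * s + y%:C%C * s^-1 = x%:C%C * e * (e + 'i * (2 * rC)) / s.
  have -> : y%:C%C = x%:C%C * rC ^+ 2 by rewrite -r2 rmorphM rmorphXn.
  apply: (canRL (mulfK s0)); rewrite mulrDl divfK // /s.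
  transitivity (x%:C%C * ((e + 'i * rC) * (e + 'i * rC) - 'i ^+ 2 * rC ^+ 2)).
    by rewrite sqrCi; ring.
  by ring.
have w0 : x%:C%C * s + y%:C%C * s^-1 != 0.
  by rewrite E !mulf_neq0 ?invr_eq0 // gt_eqF.
exists (x%:C%C * s + y%:C%C * s^-1); last first.
  by apply: has_valueD => //; [exact: (@has_value_elem _ Spring) |
    exact: (@has_value_elem _ Inerter)].
have -> : (x%:C%C * s + y%:C%C * s^-1)^-1 =
    2^-1 / x%:C%C / e + (2^-1 / x%:C%C) * (e + 'i * (2 * rC))^-1.
  rewrite E /s; field; rewrite s20 s0 !gt_eqF //=.
have m_gt0 : 0 < 2^-1 / x%:C%C by rewrite divr_gt0 ?invr_gt0 ?ltr0n.
rewrite raddfD /= (Creal_ReP _ _) ?gtr0_real ?divr_gt0 ?invr_gt0 ?ltr0n //.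
by rewrite lerDl ReMl ?gtr0_real // mulr_ge0 ?(ltW m_gt0) // ltW // Re_inv_gt0 ?s2Re.
Qed.

Lemma has_resonatorP T Z : has_resonator T -> realizes T Z -> resonant Z.
Proof.
have base T' Z' : resonator T' -> realizes T' Z' -> resonant Z'.
  rewrite /resonator !inE => /orP[] /eqP-> [_ [_ [[x x0 ->] [y y0 ->] ->]]].
    exact: resonator_value.
  by rewrite addrC; exact: resonator_value.
elim: T Z => [t|T1 _ T2 _|T1 _ T2 IH2] Z; [exact: base|exact: base|] => /= hT.
move=> [Z1 [Z2 [H1 H2 ->]]].
(* The rest of the network has an admittance with positive real part, so it cannot cancel the
   growth. *)
have aux T' Z1' Z2' : resonant Z1' -> realizes T' Z2' ->
    resonant (Z1'^-1 + Z2'^-1)^-1.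
  move=> [r [m m0 H]] HZ; exists r, m => // e e0.
  have [w1 w1_ge v1] := H e e0.
  have sRe : 'Re (e + 'i * r%:C%C) = e.
    by apply: Re_rect; [exact: gtr0_real | exact: realC].
  have [|w2 w2_gt0 v2] := positive_real_value _ HZ (s := e + 'i * r%:C%C).
    by rewrite sRe.
  have w2V := Re_inv_gt0 w2_gt0.
  exists (w1^-1 + w2^-1)^-1.
    by rewrite invrK raddfD /= (le_trans w1_ge) // lerDl ltW.
  apply: has_value_parallel => //.
  have : 0 < 'Re (w1^-1 + w2^-1).
    by rewrite raddfD /= ltr_wpDl // (le_trans _ w1_ge) // divr_ge0 ?ltW.
  by apply: contraTneq => ->; rewrite raddf0 ltxx.
case/orP: hT => hT; first by apply: aux H2; exact: base H1.
by rewrite addrC; apply: aux H1; exact: IH2.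
Qed.

Lemma poly_near_bound (p : {poly R[i]}) z :
  exists2 B, 0 < B & forall e, 0 < e <= 1 -> `|p.[z + e]| <= B.
Proof.
elim/poly_ind: p => [|p x [B B0 H]].
  by exists 1 => // e _; rewrite horner0 normr0 ler01.
exists (B * (`|z| + 1) + `|x|) => [|e e01].
  by rewrite ltr_pwDl // mulr_gt0 // ltr_wpDl.
have /andP[e0 e1] := e01.
rewrite hornerMXaddC (le_trans (ler_normD _ _)) // lerD2r normrM ler_pM ?H //.
by rewrite (le_trans (ler_normD _ _)) // lerD2l gtr0_norm.
Qed.

Lemma poly_near_lipschitz (p : {poly R[i]}) z :
  exists2 B, 0 < B & forall e, 0 < e <= 1 -> `|p.[z]| <= `|p.[z + e]| + B * e.
Proof.
have /factor_theorem[q Eq] : root (p - p.[z]%:P) z.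
  by rewrite /root !hornerE subrr.
have [B B0 H] := poly_near_bound q z; exists B => // e e01.
have /andP[e0 _] := e01.
have E : p.[z + e] - p.[z] = q.[z + e] * e.
  have := congr1 (horner^~ (z + e)) Eq; rewrite !hornerE => ->.
  by rewrite addrAC subrr add0r.
have -> : p.[z] = p.[z + e] - q.[z + e] * e by rewrite -E opprB addrC subrK.
rewrite (le_trans (ler_normB _ _)) // lerD2l normrM (gtr0_norm e0).
by rewrite ler_wpM2r ?H // ltW.
Qed.

(** At distance e from z = i r the impedance has modulus at most e / m. Since [d] is bounded and [a]
    is Lipschitz near z, the modulus of a(z) is O(e), hence zero. *)
Lemma resonant_root a d Z : Z = a%:F / d%:F -> d != 0 -> resonant Z ->
  exists r : R, ev a ('i * r%:C%C) = 0.
Proof.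
move=> Za d0 [r [m m0 H]]; exists r; set z := 'i * _.
have [A A0 HA] := poly_near_lipschitz (map_poly (real_complex R) a) z.
have [D D0 HD] := poly_near_bound (map_poly (real_complex R) d) z.
apply/eqP; rewrite -normr_le0 real_leNgt ?normr_real //; apply/negP => az0.
apply: (not_all_small az0 (_ : 0 < D / m + A)).
  by rewrite addr_gt0 ?divr_gt0.
move=> e e01; have /andP[e0 _] := e01.
apply: le_trans (HA e e01) _; rewrite [z + e]addrC.
have [w w_ge v] := H e e0.
rewrite -/(ev a (e + z)) (has_value_ev Za d0 v) mulrDl lerD2r normrM.
have le_w : `|w| <= e / m.
  have m_le : m / e <= `|w|^-1.
    by rewrite -normfV (le_trans w_ge) //; case: (leif_Re_Creal w^-1).
  have w_gt0 : 0 < `|w|^-1 by rewrite (lt_le_trans _ m_le) // divr_gt0.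
  by rewrite -[leLHS]invrK -[leRHS]invf_div lef_pV2 // posrE divr_gt0.
rewrite -mulrA [D * _]mulrC [m^-1 * e]mulrC ler_pM //.
by rewrite /ev addrC HD.
Qed.

End Exclusion.

(** * One damper in parallel with a lossless branch *)

Section OneDamper.
Variable R : realType.
Local Notation F := {fraction {poly R}}.
Implicit Types (T : tree) (Z : F) (s w : R[i]) (p a d : {poly R}).

(** The quotient n / m is the impedance of the lossless branch, so Z inherits the zeros of [n] at
    which [m] is nonzero. *)
Lemma one_damper_impedance (K : fieldType) (g x y x1 y1 s : K) :
    let m := s * (y1 + x1 * s ^+ 2) in
    let n := (x * s ^+ 2 + y) * (y1 + x1 * s ^+ 2) + x1 * y1 * s ^+ 2 in
    g != 0 -> x1 != 0 -> y1 != 0 -> m != 0 -> n != 0 -> n + g * m != 0 ->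
  ((g * 1)^-1 + (x * s + (y * s^-1 + ((y1 * s^-1)^-1 + (x1 * s)^-1)^-1))^-1)^-1 =
  g * n / (n + g * m).
Proof.
move=> m n g0 x10 y10; rewrite mulf_eq0 => /norP[s0 v0] n0 gn0.
have -> : x * s + (y * s^-1 + ((y1 * s^-1)^-1 + (x1 * s)^-1)^-1) = n / m.
  by rewrite /n /m; field; rewrite v0 s0 x10.
have m0 : m != 0 by rewrite mulf_neq0.
by clearbody m n; field; rewrite gn0 m0 n0.
Qed.

Lemma antiresonance (x y x1 y1 : R) : 0 < x -> 0 < y -> 0 < x1 -> 0 < y1 ->
  exists2 r, (y - x * r ^+ 2) * (y1 - x1 * r ^+ 2) - x1 * y1 * r ^+ 2 = 0 &
    r * (y1 - x1 * r ^+ 2) != 0.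
Proof.
move=> x0 y0 x10 y10.
(* [P] is the opposite of the lossless numerator at s^2 = -t. It is negative at t = 0 and positive
   at t = y1 / x1, so it has a root r^2 between them. *)
pose P : {poly R} := x1 * y1 *: 'X - (y%:P - x *: 'X) * (y1%:P - x1 *: 'X).
have PE t : P.[t] = x1 * y1 * t - (y - x * t) * (y1 - x1 * t) by rewrite !hornerE.
have t0 : 0 <= y1 / x1 by rewrite divr_ge0 ?ltW.
have [|t /andP[t_ge0 _]] := @poly_ivt R P 0 (y1 / x1) t0.
  rewrite !PE; apply/andP; split.
    by rewrite !mulr0 !subr0 sub0r oppr_le0 mulr_ge0 ?ltW.
  have -> : x1 * (y1 / x1) = y1 by rewrite mulrC divfK ?gt_eqF.
  by rewrite subrr mulr0 subr0 !mulr_ge0 ?ltW // invr_gt0.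
rewrite /root PE subr_eq0 => /eqP Pt.
have t2 : Num.sqrt t ^+ 2 = t by rewrite sqr_sqrtr.
exists (Num.sqrt t); rewrite t2; first by rewrite Pt subrr.
have t_neq0 : t != 0.
  apply: contra_eq_neq Pt => ->; rewrite !mulr0 !subr0 eq_sym mulf_neq0 // gt_eqF //.
apply: mulf_neq0; first by rewrite -sqrf_eq0 t2.
apply: contra_eq_neq Pt => ->.
by rewrite mulr0 !mulf_neq0 // gt_eqF.
Qed.

Lemma one_damper_root a d Z : Z = a%:F / d%:F -> d != 0 ->
    realizes (Parallel c (Series k (Series b (Parallel b k)))) Z ->
  exists r : R, ev a ('i * r%:C%C) = 0.
Proof.
move=> Za d0 [_ [_ [[g g0 ->] [_ [_ [[x x0 ->] [_ [_ [[y y0 ->]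
  [_ [_ [[y1 y10 ->] [x1 x10 ->] ->]]] ->]]] ->]]] /= EZ]]].
pose m : {poly R} := 'X * (y1%:P + x1%:P * 'X ^+ 2).
pose n : {poly R} :=
  (x%:P * 'X ^+ 2 + y%:P) * (y1%:P + x1%:P * 'X ^+ 2) + x1%:P * y1%:P * 'X ^+ 2.
have ev_m s : ev m s = s * (y1%:C%C + x1%:C%C * s ^+ 2).
  by rewrite /m expr2 !evE expr2.
have ev_n s : ev n s = (x%:C%C * s ^+ 2 + y%:C%C) * (y1%:C%C + x1%:C%C * s ^+ 2)
    + x1%:C%C * y1%:C%C * s ^+ 2.
  by rewrite /n expr2 !evE expr2.
have mF : m%:F = 'X%:F * (cst y1 + cst x1 * 'X%:F ^+ 2).
  by rewrite tofracM tofracD tofracM tofracXn.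
have nF : n%:F = (cst x * 'X%:F ^+ 2 + cst y) * (cst y1 + cst x1 * 'X%:F ^+ 2)
    + cst x1 * cst y1 * 'X%:F ^+ 2.
  by rewrite /n !expr2 !(tofracD, tofracM).
clearbody m n.
(* Positivity at s = 1 shows that these polynomials are nonzero, which justifies the
   cross-multiplication. *)
have m1 : 0 < ev m 1 by rewrite ev_m expr1n !mulr1 mul1r addr_gt0 ?ltC0.
have n1 : 0 < ev n 1.
  by rewrite ev_n expr1n !mulr1 addr_gt0 ?mulr_gt0 ?addr_gt0 ?ltC0.
have gnm1 : 0 < ev (n + g%:P * m) 1.
  by rewrite !evE addr_gt0 // mulr_gt0 ?ltC0.
have gmF : (n + g%:P * m)%:F = n%:F + cst g * m%:F by rewrite tofracD tofracM.
have neq0 p : 0 < ev p 1 -> p%:F != 0 :> F.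
  by move=> p1; apply: (@ev_neq0 _ _ 1); rewrite gt_eqF.
have := one_damper_impedance (cst_neq0 g0) (cst_neq0 x10) (cst_neq0 y10).
move=> /(_ (cst x) (cst y) 'X%:F); rewrite -mF -nF -gmF.
move=> /(_ (neq0 m m1) (neq0 n n1) (neq0 _ gnm1)); rewrite -EZ Za => /eqP.
have dF : d%:F != 0 :> F by rewrite tofrac_eq0.
rewrite (eqr_div _ _ dF (neq0 _ gnm1)) -[cst g]/(g%:P%:F) -!tofracM tofrac_eq.
move=> /eqP E.
(* By [E], a (n + g m) = g n d. At i r, [n] vanishes and [m] does not, hence [a] vanishes. *)
have [r nr mr] := antiresonance x0 y0 x10 y10; exists r.
have i2 : ('i * r%:C%C) ^+ 2 = - (r ^+ 2)%:C%C :> R[i].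
  by rewrite exprMn sqrCi mulN1r rmorphXn.
have nz : ev n ('i * r%:C%C) = 0.
  have := congr1 (real_complex R) nr; rewrite ev_n i2.
  rewrite !(rmorphB, rmorphM, rmorphXn, rmorph0) /= => <-; ring.
have mz : ev m ('i * r%:C%C) != 0.
  move: mr; rewrite ev_m i2 -(fmorph_eq0 (real_complex R)).
  rewrite rmorphM rmorphB rmorphM /= mulrN !mulf_eq0 !negb_or => /andP[r0 ->].
  by rewrite r0 neq0Ci.
have := congr1 (fun p => ev p ('i * r%:C%C)) E; rewrite !evE nz mulr0 mul0r add0r.
move=> /eqP; rewrite !mulf_eq0 (negPf mz) orbF fmorph_eq0 (gt_eqF g0) orbF.
by move/eqP.
Qed.

End OneDamper.

(** * Classification *)

Lemma size_sp_elements_gt0 (E : Type) (T : sp E) : (0 < size (sp_elements T))%N.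
Proof. by elim: T => //= T1 H1 T2 H2; rewrite size_cat addn_gt0 H1. Qed.

Lemma mem_canonical_trees fuel (T : tree) :
  (size (sp_elements T) <= fuel)%N ->
  canon true T \in canonical_trees fuel (size (sp_elements T)).
Proof.
elim: fuel T => [|fuel IH] T; first by rewrite leqNgt size_sp_elements_gt0.
have step o T1 T2 : (size (sp_elements T1 ++ sp_elements T2) <= fuel.+1)%N ->
    join true o (canon true T1) (canon true T2) \in
    canonical_trees fuel.+1 (size (sp_elements T1 ++ sp_elements T2)).
  rewrite size_cat; have := size_sp_elements_gt0 T1; have := size_sp_elements_gt0 T2.
  set m := size (sp_elements T1); set n := size (sp_elements T2) => n0 m0 le_fuel.
  have m_fuel : (m <= fuel)%N by lia.
  have n_fuel : (n <= fuel)%N by lia.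
  have mn1 : (m + n == 1)%N = false.
    by apply/eqP; lia.
  rewrite /= mn1 /combine mem_undup; apply/flattenP.
  pose s := [seq join true o S1 S2 |
    S1 <- canonical_trees fuel m, S2 <- canonical_trees fuel (m + n - m)].
  exists s; last first.
    apply/allpairsP; exists (canon true T1, canon true T2).
    by split; rewrite //= ?addKn; apply: IH.
  (* The split to pick is the one by the size of the left subtree, which lies strictly between 0 and
     the total. *)
  apply/mapP; exists (o, m) => //; apply/allpairsP.
  exists (o, m); split=> //=; first by case: (o).
  rewrite mem_iota m0 /= add1n prednK ?addn_gt0 ?m0 //.
  by rewrite -[X in (X < _)%N]addn0 ltn_add2l.
case: T => [[]|T1 T2|T1 T2] //.
- exact: step.
- exact: step.
Qed.

Lemma mem_In (E : eqType) (x : E) (s : seq E) : x \in s -> List.In x s.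
Proof.
by elim: s => //= y s IH; rewrite inE => /orP[/eqP->|/IH]; [left | right].
Qed.

(** * From the exclusions to the 22 configurations *)

Section Main.
Variable R : realType.
Local Notation F := {fraction {poly R}}.
Implicit Types (T : tree) (Z : F) (p a d : {poly R}).
Local Notation reduces := (reduces R).

Lemma reduces_zobel_parallel t T :
  reduces (Parallel (Elem t) (Series (Elem t) T))
         (Series (Elem t) (Parallel (Elem t) T)).
Proof.
have H u := reduces_dual (@reduces_zobel_series R u (dual T)).
rewrite /= dualK in H.
case: t; [exact: H Damper | exact: H Inerter | exact: H Spring].
Qed.

Lemma reduces_series T1 T2 T2' :
  reduces T2 T2' -> reduces (Series T1 T2) (Series T1 T2').
Proof. exact: (@reduces_node _ true). Qed.

Lemma reduces_parallel T1 T2 T2' :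
  reduces T2 T2' -> reduces (Parallel T1 T2) (Parallel T1 T2').
Proof. exact: (@reduces_node _ false). Qed.

Lemma reduces_one_damper T : canon false T \in map (canon false) one_damper ->
  reduces T (Parallel c (Series k (Series b (Parallel b k)))).
Proof.
move=> /mapP[T' T'in /reduces_same_canon H]; apply: reduces_trans (H R) _.
move: T'in; rewrite !inE => /or3P[] /eqP-> //.
- apply: (@reduces_trans _ (Parallel c (Series b (Series k (Parallel k b))))).
    by apply/reduces_parallel/reduces_series/reduces_zobel_parallel.
  exact: reduces_same_canon.
- apply: reduces_parallel; apply: reduces_series.
  exact: reduces_zobel_parallel.
Qed.

Lemma reduces_zobel_variants T : T \in zobel_variants ->
  exists2 C, C \in the_22_configurations & reduces T (structure C).
Proof.
(* Intermediate forms for the variants that need two Zobel transformations. *)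
pose N1a' : tree := Series c (Parallel c (Parallel k (Series k b))).
pose N1b' : tree := Series c (Parallel c (Parallel b (Series b k))).
have H1a : reduces N1a' (structure N1a) by exact: reduces_zobel_series.
have H1b : reduces N1b' (structure N1b).
  by apply/reduces_series/reduces_parallel/reduces_zobel_parallel.
rewrite !inE => /or4P[| | |/or4P[| | |/or4P[| | |]]] /eqP->.
- exists N1a => //; apply: reduces_trans H1a.
  by apply/reduces_series/reduces_parallel/reduces_zobel_series.
- by exists N1a.
- exists N1a => //.
  by apply/reduces_parallel/reduces_series/reduces_zobel_series.
- by exists N1b => //; apply: reduces_zobel_parallel.
- exists N1b => //; apply: reduces_trans H1b.
  exact: reduces_zobel_parallel.
- by exists N1b.
- exists N2b => //.
  by apply/reduces_series/reduces_parallel/reduces_zobel_parallel.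
- exists N2a => //.
  by apply/reduces_parallel/reduces_series/reduces_zobel_series.
- exists N2d => //.
  by apply/reduces_series/reduces_parallel/reduces_zobel_parallel.
- exists N2c => //.
  by apply/reduces_parallel/reduces_series/reduces_zobel_series.
Qed.

(** The hypotheses on Z in a form symmetric under inversion, so that every exclusion also applies to
    the dual structure with impedance 1/Z. *)
Record regular Z a d : Prop := Regular {
  regular_frac : Z = a%:F / d%:F;
  regular_coprime : coprimep a d;
  regular_num : positive_cubic a;
  regular_den : positive_cubic d;
  regular_zero : forall r : R, ev a ('i * r%:C%C) <> 0;
  regular_pole : forall r : R, ev d ('i * r%:C%C) <> 0 }.

Lemma positive_cubic_neq0 p : positive_cubic p -> p != 0.
Proof. by case=> sp _; rewrite -size_poly_eq0 sp. Qed.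

Lemma regularV Z a d : regular Z a d -> regular Z^-1 d a.
Proof.
case=> Za ad a_pos d_pos a_root d_root; split=> //; last by rewrite coprimep_sym.
by rewrite Za invf_div.
Qed.

Lemma regular_not_degenerate Z a d T :
  regular Z a d -> realizes T Z -> ~~ degenerate T.
Proof.
case=> Za _ a_pos d_pos a_root _ HT.
have d0 := positive_cubic_neq0 d_pos.
have := short_excluded Za a_pos d_pos HT.
rewrite /degenerate => /norP[/negbTE-> /negbTE->] /=.
apply/norP; split; apply/negP.
  by move=> /has_resonatorP/(_ HT)/(resonant_root Za d0)[r /a_root].
by move=> /reduces_one_damper/(_ Z HT)/(one_damper_root Za d0)[r /a_root].
Qed.

(** By coprimality [d], of degree 3, divides every denominator of Z; two reactive elements would
    give one of degree at most 2. *)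
Lemma regular_reactive Z a d T :
  regular Z a d -> realizes T Z -> (2 < reactive T)%N.
Proof.
case=> Za ad [sa _] [sd _] _ _ /realizes_degree[p [q [Zp q0 sp sq]]].
rewrite ltnNge; apply/negP => T2.
have d0 : d != 0 by rewrite -size_poly_eq0 sd.
have E : a * q = p * d by apply: (frac_cross (R := R)); rewrite // -Za -Zp.
have : d %| q.
  by rewrite -(Gauss_dvdpr q (_ : coprimep d a)) ?E ?dvdp_mull // coprimep_sym.
move=> /(dvdp_leq q0); rewrite sd leqNgt => /negP; apply.
by rewrite ltnS (leq_trans sq).
Qed.

Lemma regular_configuration Z a d T :
    regular Z a d -> size (sp_elements T) = 5%N -> realizes T Z ->
  exists2 C, C \in the_22_configurations & realizable_as C Z.
Proof.
move=> reg sT HT; have HT' := reduces_canon true HT.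
have := mem_canonical_trees (eq_leq sT); rewrite sT.
move=> /(allP canonical_trees_settled); move: (canon true T) HT' => {HT sT}T HT.
rewrite /settled leqNgt (regular_reactive reg HT).
rewrite (negbTE (regular_not_degenerate reg HT)).
rewrite (negbTE (regular_not_degenerate (regularV reg) (realizes_dual HT))) !orFb.
move=> /mapP[T' T'in /reduces_same_canon/(_ Z HT) {}HT].
have [C C22 HC] : exists2 C, C \in the_22_configurations & realizes (structure C) Z.
  move: T'in; rewrite mem_cat => /orP[/mapP[C C22 ET]|/reduces_zobel_variants].
    by exists C => //; rewrite -ET.
  by move=> [C C22 W]; exists C => //; apply: W.
exists C => //; apply: realizes_realizable_as => //.
by apply: (allP (_ : all (fun C => uniq (sp_elements C)) the_22_configurations)).
Qed.

(** A coprime fraction for Z differs from a / d by a common factor [g], and equality of the degrees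
    forces [g] to be constant. *)
Lemma McMillan_degree_coprime Z a d n : Z = a%:F / d%:F ->
  size a = n.+2 -> size d = n.+2 -> McMillan_degree Z n.+1 -> coprimep a d.
Proof.
move=> Za sa sd [a' [d' [[ad' d'0 Za'] deg]]].
have a0 : a != 0 by rewrite -size_poly_eq0 sa.
have d0 : d != 0 by rewrite -size_poly_eq0 sd.
have E : a * d' = a' * d by apply: (frac_cross (R := R)); rewrite // -Za -Za'.
have /dvdpP[g Eg] : d' %| d.
  by rewrite -(Gauss_dvdpr d (_ : coprimep d' a')) -?E ?dvdp_mull // coprimep_sym.
have Ea : a = g * a'.
  by apply: (mulIf d'0); rewrite E Eg mulrCA mulrA.
have /norP[g0 a'0] : ~~ ((g == 0) || (a' == 0)) by rewrite -mulf_eq0 -Ea.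
have : size g = 1%N.
  move: sa sd deg; rewrite Ea Eg !size_mul // => sa sd deg.
  have sa'0 : (0 < size a')%N by rewrite size_poly_gt0.
  have sd'0 : (0 < size d')%N by rewrite size_poly_gt0.
  have sg0 : (0 < size g)%N by rewrite size_poly_gt0.
  move: (size g) (size a') (size d') sa sd deg sa'0 sd'0 sg0 => x y z *; lia.
move/eqP/size_poly1P => [x x0 Ex].
by rewrite Ea Eg Ex !mul_polyC coprimepZl // coprimepZr.
Qed.

Definition cubic (x0 x1 x2 x3 : R) : {poly R} :=
  x3 *: 'X^3 + x2 *: 'X^2 + x1 *: 'X + x0%:P.

Lemma cubic_positive x0 x1 x2 x3 : 0 < x0 -> 0 < x1 -> 0 < x2 -> 0 < x3 ->
  positive_cubic (cubic x0 x1 x2 x3).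
Proof.
move=> x00 x10 x20 x30.
have -> : cubic x0 x1 x2 x3 = Poly [:: x0; x1; x2; x3].
  apply/polyP => i; rewrite coef_Poly /cubic !coefE.
  by case: i => [|[|[|[|i]]]]; rewrite /= ?mulr0 ?mulr1 ?add0r ?addr0 // nth_nil.
rewrite /positive_cubic (@PolyK _ 0) /= ?gt_eqF //; split=> //.
by move=> [|[|[|[|i]]]].
Qed.

End Main.

Theorem lemma5 (R : realType) (a0 a1 a2 a3 d0 d1 d2 d3 : R)
    (Z : {fraction {poly R}})
    (a_pos : [/\ 0 < a0, 0 < a1, 0 < a2 & 0 < a3])
    (d_pos : [/\ 0 < d0, 0 < d1, 0 < d2 & 0 < d3])
    (Z_def : Z = (a3 *: 'X^3 + a2 *: 'X^2 + a1 *: 'X + a0%:P)%:F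
               / (d3 *: 'X^3 + d2 *: 'X^2 + d1 *: 'X + d0%:P)%:F)
    (Z_deg : McMillan_degree Z 3)
    (Z_jR : forall p : option R[i], on_jR_infty p ->
              ~ is_pole Z p /\ ~ is_zero Z p) :
  sp_realizable 5 Z <->
  exists C : configuration,
    List.In C the_22_configurations /\ realizable_as C Z.
Proof.
split; last first.
  (* Each configuration is itself a series-parallel network with five elements. *)
  move=> [C [C22 [v [v_gt0 <-]]]]; exists (assign_values v C); split=> //.
    rewrite /positive_values /assign_values.
    elim: C {C22} => [e|C1 IH1 C2 IH2|C1 IH1 C2 IH2] /=; first by rewrite v_gt0.
      by rewrite all_cat IH1.
    by rewrite all_cat IH1.
  by move: C22; do 22!case=> [<- //|].
case=> N [N_pos N5 EN].
case: a_pos => a00 a10 a20 a30; case: d_pos => d00 d10 d20 d30.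
have ca := cubic_positive a00 a10 a20 a30; have cd := cubic_positive d00 d10 d20 d30.
rewrite -!/(cubic _ _ _ _) in Z_def.
move: (cubic a0 a1 a2 a3) (cubic d0 d1 d2 d3) Z_def ca cd => a d Z_def ca cd.
have ad : coprimep a d.
  by apply: McMillan_degree_coprime Z_def _ _ Z_deg; [case: ca | case: cd].
have rep : coprime_rep Z a d by split=> //; exact: positive_cubic_neq0.
(* The points i r are those of the imaginary axis in the sense of the hypothesis, so neither [a] nor
   [d] vanishes there. *)
have jR (r : R) : on_jR_infty (Some ('i * r%:C%C : R[i])).
  apply: complexI; rewrite complexRe ReMil (Creal_ImP _ _) ?oppr0 ?rmorph0 //.
  exact: realC.
have reg : regular Z a d.
  split=> // r E; have [no_pole no_zero] := Z_jR _ (jR r).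
    by apply: no_zero; exists a, d; split=> //; apply/rootP.
  by apply: no_pole; exists a, d; split=> //; apply/rootP.
have HN := realizes_impedance N_pos; rewrite EN in HN.
have sN : size (sp_elements (sp_map fst N)) = 5%N.
  rewrite -N5; elim: {N_pos N5 EN HN} N => //= N1 IH1 N2 IH2.
    by rewrite !size_cat IH1 IH2.
  by rewrite !size_cat IH1 IH2.
have [C /mem_In C22 HC] := regular_configuration reg sN HN.
by exists C.
Qed.
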